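(* Let $G$ be a strongly connected digraph. Then its Kirchhoff polynomial $\kappa(G)$ is prime.
   Context: Digraphs are finite directed graphs without loops; parallel edges are allowed. An arborescence of a digraph $G=(V,E)$ is a subdigraph $A$ spanning all of $V$ with a root vertex from which every vertex is reachable along a unique directed path in $A$ (a rooted directed spanning tree with edges directed away from the root). Arborescences are identified with their edge sets. Let $\mathsf{arb}(G)$ be the set of all arborescences of $G$ (over all roots). Each edge $e\in E$ is regarded as a variable, distinct edges being distinct variables. The Kirchhoff polynomial is $\kappa(G)=\sum_{A\in\mathsf{arb}(G)}\prod_{e\in A}e\in\mathbb{Q}[e : e\in E]$; for a one-vertex digraph $\kappa(G)=1$. A polynomial is called prime if it has only trivial factors, i.e. whenever it equals $P\cdot Q$, one of $P,Q$ is a constant (with this convention the constant $1$ counts as prime). $G$ is strongly connected if for any two vertices $u,w$ there are directed paths from $u$ to $w$ and from $w$ to $u$. *)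

(* Defs.v *)
From HB Require Import structures.
From mathcomp Require Import all_boot all_order all_algebra.
From mathcomp Require Import boolp.
From mathcomp Require Import mpoly.

Set Implicit Arguments.
Unset Strict Implicit.
Unset Printing Implicit Defensive.

Import GRing.Theory.
Local Open Scope ring_scope.

Record digraph := Digraph {
  vertex : finType;
  edge : finType;
  src : edge -> vertex;
  tgt : edge -> vertex;
  loopless : forall e : edge, src e != tgt e
}.

(* A directed path is a sequence of edges rather than of vertices, so that
   paths through different parallel edges are different; [::] is the path of
   length 0 from u to u.  Vertices may repeat: this does not affect
   reachability, and in [arborescence] it makes uniqueness exclude directed
   cycles. *)
Fixpoint dipath (G : digraph) (u : vertex G) (p : seq (edge G))
    (w : vertex G) : Prop :=
  if p is e :: p' then src e = u /\ dipath (tgt e) p' w else u = w.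

Definition strongly_connected (G : digraph) : Prop :=
  forall u w : vertex G,
    (exists p, dipath u p w) /\ (exists p, dipath w p u).

Definition arborescence (G : digraph) (A : {set edge G}) : Prop :=
  exists r : vertex G, forall v : vertex G,
    exists! p : seq (edge G), {subset p <= A} /\ dipath r p v.

Definition arb (G : digraph) : {set {set edge G}} :=
  [set A : {set edge G} | `[< arborescence A >]].

Definition kirchhoff (G : digraph) : {mpoly rat[#|edge G|]} :=
  \sum_(A in arb G) \prod_(e in A) 'X_(enum_rank e).

Definition constant_mpoly (n : nat) (p : {mpoly rat[n]}) : Prop :=
  exists c : rat, p = c%:MP.

(* Unlike for irreducible elements of a ring, constants (in particular 1) are
   not excluded. *)
Definition prime_mpoly (n : nat) (p : {mpoly rat[n]}) : Prop :=
  forall P Q : {mpoly rat[n]},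
    p = P * Q -> constant_mpoly P \/ constant_mpoly Q.

(* Main.v *)
(**
Suppose [kirchhoff G = P * Q].  The Kirchhoff polynomial has degree at most 1
in each variable, so no variable occurs in both [P] and [Q]; hence, with [S]
the set of edges occurring in [P], the [S]-part of one arborescence and the
[~: S]-part of another always form an arborescence again.

Let [e] be an edge in [S] and [f] one outside.  Every edge lies in some
arborescence, so two edges with the same target lie on the same side of [S]:
otherwise an exchange would put both into one arborescence.  In particular
[tgt e != tgt f].  Exchanging an arborescence rooted at [tgt f] (which enters
every target of an edge of [S]) with one rooted at [tgt e] (which enters all
other vertices) gives an edge set entering every vertex: not an arborescence.
*)

Require Import Defs.
From mathcomp Require Import all_boot all_order all_algebra.
From mathcomp Require Import boolp.
From mathcomp Require Import mpoly.

Set Implicit Arguments.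
Unset Strict Implicit.
Unset Printing Implicit Defensive.

(** * Arborescences with a given root and the edges entering each vertex *)

Definition rooted_arborescence (G : digraph) (r : vertex G)
    (A : {set edge G}) : Prop :=
  forall v, exists! p, {subset p <= A} /\ dipath r p v.

Lemma dipath_rcons (G : digraph) (u w : vertex G) p e :
  dipath u (rcons p e) w <-> dipath u p (src e) /\ tgt e = w.
Proof.
elim: p u => [|f p IHp] u /=; first by split=> -[-> ->].
by rewrite IHp; tauto.
Qed.

Lemma subset_rcons (T : eqType) (s : seq T) x (A : {pred T}) :
  {subset rcons s x <= A} <-> {subset s <= A} /\ x \in A.
Proof.
split=> [sA | [sA xA] y].
  split=> [y ys|]; apply: sA; rewrite mem_rcons inE ?eqxx //.
  by rewrite ys orbT.
by rewrite mem_rcons inE => /predU1P[->|/sA].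
Qed.

Section RootedArborescence.

Variables (G : digraph) (r : vertex G) (A : {set edge G}).
Hypothesis rA : rooted_arborescence r A.

(** An edge into the root would close a nonempty path from [r] to [r], which competes with
    [[::]]. *)
Lemma rooted_tgt_neq e : e \in A -> tgt e != r.
Proof.
move=> eA; apply/eqP => er.
have [p [[pA rp] _]] := rA (src e).
have [q [_ q_uniq]] := rA r.
have q_nil : q = [::] by apply: q_uniq.
have: q = rcons p e by apply: q_uniq; rewrite subset_rcons dipath_rcons.
by rewrite q_nil; case: (p).
Qed.

Lemma rooted_tgt_inj : {in A &, injective (@tgt G)}.
Proof.
move=> e f eA fA ef.
have [p [[pA rp] _]] := rA (src e).
have [q [[qA rq] _]] := rA (src f).
have [s [_ s_uniq]] := rA (tgt e).
have sp : s = rcons p e by apply: s_uniq; rewrite subset_rcons dipath_rcons.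
have sq : s = rcons q f.
  by apply: s_uniq; rewrite subset_rcons dipath_rcons -ef.
by have /rcons_inj[] : rcons p e = rcons q f by rewrite -sp.
Qed.

Lemma rooted_in_edge v : v != r -> exists2 e, e \in A & tgt e = v.
Proof.
have [p [[pA rp] _]] := rA v.
case/lastP: p pA rp => [_ /= ->|p e]; first by rewrite eqxx.
by rewrite subset_rcons dipath_rcons => -[_ eA] [_ ev] _; exists e.
Qed.

End RootedArborescence.

(** * Existence of arborescences through a given edge or with a given root *)

Lemma parent_rooted_arborescence (G : digraph) (r : vertex G)
    (parent : vertex G -> edge G) (depth : vertex G -> nat) :
  (forall v, v != r ->
    tgt (parent v) = v /\ depth (src (parent v)) < depth v) ->
  rooted_arborescence r (parent @: [set~ r]).
Proof.
move=> parentP v.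
have [n] := ubnP (depth v); elim: n v => // n IHn v; rewrite ltnS => le_v.
have nil_uniq p : {subset p <= parent @: [set~ r]} -> dipath r p r -> p = [::].
  case/lastP: p => // p e /subset_rcons[_ /imsetP[w]].
  rewrite !inE => wr -> /dipath_rcons[_].
  by have [-> _] := parentP w wr => /eqP; rewrite (negPf wr).
have [->|vr] := eqVneq v r.
  by exists [::]; split=> // p [pA rp]; rewrite (nil_uniq p).
have [tv dv] := parentP v vr.
have [|p [[pA rp] p_uniq]] := IHn (src (parent v)).
  exact: leq_trans dv le_v.
exists (rcons p (parent v)); split.
  rewrite subset_rcons dipath_rcons; split=> //; split=> //.
  by apply: imset_f; rewrite !inE.
(* Paths are compared from their last edge: the only edge of the set entering [v] is [parent v], and
   induction on depth settles the rest. *)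
move=> q; case/lastP: q => [[_ /= rv]|q e]; first by rewrite rv eqxx in vr.
rewrite subset_rcons dipath_rcons => -[[qA /imsetP[w]]].
rewrite !inE => wr -> [rq].
have [-> _] := parentP w wr => wv; rewrite wv in rq *.
by rewrite (p_uniq q).
Qed.

(** A breadth-first tree from [src e]: each other vertex takes as parent edge the last edge of a
    shortest path, and [e] itself may be taken for [tgt e], which is at distance 1. *)
Lemma edge_rooted_arborescence (G : digraph) (e : edge G) :
  strongly_connected G ->
  exists2 A : {set edge G}, e \in A & rooted_arborescence (src e) A.
Proof.
move=> hG; set r := src e.
have dist_ex v : exists n, `[< exists2 p, dipath r p v & size p = n >].
  by have [[p rp] _] := hG r v; exists (size p); apply/asboolP; exists p.
pose dist v := ex_minn (dist_ex v).
have distP v : exists2 p, dipath r p v & size p = dist v.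
  by rewrite /dist; case: ex_minnP => n /asboolP.
have dist_min v p : dipath r p v -> dist v <= size p.
  move=> rp; rewrite /dist; case: ex_minnP => n _; apply.
  by apply/asboolP; exists p.
have er : tgt e != r by rewrite eq_sym loopless.
have parent_ex v : exists f, (v != r -> tgt f = v /\ dist (src f) < dist v)
    /\ (v = tgt e -> f = e).
  have [->|ve] := eqVneq v (tgt e).
    exists e; split=> // _; split=> //.
    apply: (@leq_ltn_trans 0); first exact: (dist_min _ [::]).
    have [p + <-] := distP (tgt e).
    by case: p => //= re; rewrite re eqxx in er.
  have [->|vr] := eqVneq v r.
    (* The root has no parent edge; [e] is a dummy value here. *)
    by exists e; split=> // re; rewrite re eqxx in er.
  have [p + <-] := distP v.
  case/lastP: p => [/= rv|p f]; first by rewrite rv eqxx in vr.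
  rewrite dipath_rcons => -[rp tf]; exists f; split=> [_|/eqP].
    by rewrite size_rcons ltnS; split=> //; apply: dist_min.
  by rewrite (negPf ve).
have [parent parentP] := choice parent_ex.
exists (parent @: [set~ r]).
  have [_ <- //] := parentP (tgt e).
  by apply: imset_f; rewrite !inE.
by apply: (@parent_rooted_arborescence _ _ _ dist) => v; have [] := parentP v.
Qed.

Lemma in_arb (G : digraph) r (A : {set edge G}) :
  rooted_arborescence r A -> A \in arb G.
Proof. by move=> rA; rewrite inE; apply/asboolP; exists r. Qed.

Lemma arb_rooted (G : digraph) (A : {set edge G}) :
  A \in arb G -> exists r, rooted_arborescence r A.
Proof. by rewrite inE => /asboolP. Qed.

Lemma rooted_arborescence_at (G : digraph) (r v : vertex G) :
  strongly_connected G -> r != v ->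
  exists A : {set edge G}, rooted_arborescence r A.
Proof.
move=> hG rv; have [[[|e p] /= rp] _] := hG r v; first by rewrite rp eqxx in rv.
by case: rp => <- _; have [A _ ?] := edge_rooted_arborescence e hG; exists A.
Qed.

(** * The exchange argument on edge sets *)

Lemma arb_exchange_trivial (G : digraph) (S : {set edge G}) :
  strongly_connected G ->
  {in arb G &, forall A B, (A :&: S) :|: (B :\: S) \in arb G} ->
  S = set0 \/ S = setT.
Proof.
move=> hG swap; have [->|/set0Pn[e eS]] := eqVneq S set0; first by left.
right; apply/setP => f; rewrite inE; apply: contraT => fS.
have same_tgt e' f' : e' \in S -> f' \notin S -> tgt e' != tgt f'.
  move=> e'S f'S; apply/eqP => ef.
  have [A eA /in_arb hA] := edge_rooted_arborescence e' hG.
  have [B fB /in_arb hB] := edge_rooted_arborescence f' hG.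
  have [r rC] := arb_rooted (swap A B hA hB).
  have ef' : e' = f'.
    by apply: (rooted_tgt_inj rC); rewrite ?inE ?eA ?fB ?e'S ?f'S ?orbT.
  by rewrite -ef' e'S in f'S.
have tef : tgt e != tgt f by apply: same_tgt.
have [B rB] := rooted_arborescence_at hG tef.
have [|A rA] := @rooted_arborescence_at _ (tgt f) (tgt e) hG.
  by rewrite eq_sym.
have [r rC] := arb_rooted (swap A B (in_arb rA) (in_arb rB)).
(* The root [r] of the exchanged set is entered by an edge of [A] in [S] if it is the target of an
   edge of [S], and by an edge of [B] outside [S] otherwise; both contradict [rooted_tgt_neq]. *)
have [r_in | r_out] := boolP [exists g in S, tgt g == r].
  have /exists_inP[g gS /eqP gr] := r_in.
  have [|a aA ar] := rooted_in_edge rA (v := r).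
    by rewrite -gr; apply: same_tgt.
  have aS : a \in S by apply: contraT => /(same_tgt _ _ gS); rewrite gr ar eqxx.
  have := rooted_tgt_neq rC (e := a).
  by rewrite !inE aA aS ar eqxx => /(_ isT).
have [|b bB br] := rooted_in_edge rB (v := r).
  by apply: contra r_out => /eqP->; apply/exists_inP; exists e.
have bS : b \notin S.
  by apply: contra r_out => bS; apply/exists_inP; exists b; rewrite ?br.
have := rooted_tgt_neq rC (e := b).
by rewrite !inE bB bS br eqxx orbT => /(_ isT).
Qed.

(** * Degrees in one variable and supports of products *)

Import GRing.Theory.
Local Open Scope ring_scope.

Lemma coefM_neq0 (R : idomainType) (p q : {poly R}) i j :
  (i < size p)%N -> (j < size q)%N ->
  exists2 k, (i + j <= k)%N & (p * q)`_k != 0.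
Proof.
(* This is the degree of [p * q], whose leading coefficient is nonzero. *)
move=> ip jq; exists (size p + size q).-2.
  move: ip jq; case: (size p) => // k; case: (size q) => // l.
  by rewrite addnS /= !ltnS; apply: leq_add.
have p0 : p != 0 by rewrite -size_poly_gt0; apply: leq_trans ip.
have q0 : q != 0 by rewrite -size_poly_gt0; apply: leq_trans jq.
by rewrite -size_mul // -lead_coefE lead_coef_eq0 mulf_neq0.
Qed.

(* Replaces ['X_i] by ['X_i * 'X], so that ['X^k] collects the monomials of
   degree k in ['X_i]; as the target is an integral domain, degrees in ['X_i]
   are additive. *)
Definition split_var (n : nat) (R : idomainType) (i : 'I_n) :
    {mpoly R[n]} -> {poly {mpoly R[n]}} :=
  mmap (polyC \o mpolyC n (R := R)) (fun j => ('X_j)%:P * 'X^(j == i)).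

Lemma split_varM (n : nat) (R : idomainType) (i : 'I_n) (p q : {mpoly R[n]}) :
  split_var i (p * q) = split_var i p * split_var i q.
Proof.
exact: (mmap_is_multiplicative _ (polyC \o mpolyC n (R := R))).1.
Qed.

Lemma split_varE (n : nat) (R : idomainType) (i : 'I_n) (p : {mpoly R[n]}) :
  split_var i p = \sum_(m <- msupp p) (p@_m *: 'X_[m])%:P * 'X^(m i).
Proof.
apply: eq_bigr => m _; rewrite -mul_mpolyC polyCM -mulrA; congr (_ * _).
rewrite /mmap1 mpolyXE_id.
under eq_bigr => j _ do rewrite exprMn -exprM -rmorphXn /=.
rewrite big_split -rmorph_prod prodrXr /=; congr (_ * 'X^_).
rewrite (bigD1 i) //= eqxx mul1n.
by rewrite big1 ?addn0 // => j /negPf->.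
Qed.

(** The factor ['X_i] is kept next to the new ['X], so each coefficient still shows the full
    monomial and distinct monomials never merge. *)
Lemma coef_split_var (n : nat) (R : idomainType) (i : 'I_n)
    (p : {mpoly R[n]}) k (m : 'X_{1.. n}) :
  (split_var i p)`_k @_m = if k == m i then p@_m else 0.
Proof.
rewrite split_varE coef_sum raddf_sum /=.
under eq_bigr => m' _ do rewrite coefMXn coefC.
have [m_in|m_out] := boolP (m \in msupp p).
  rewrite (bigD1_seq m) //= big1_seq ?addr0; last first.
    move=> m' /andP[m'm _]; case: ifP => _; first by rewrite mcoeff0.
    by case: ifP => _; rewrite ?mcoeff0 // mcoeffZ mcoeffX (negPf m'm) mulr0.
  rewrite subn_eq0; case: ltngtP => _; rewrite ?mcoeff0 //.
  by rewrite mcoeffZ mcoeffX eqxx mulr1.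
rewrite (memN_msupp_eq0 m_out) if_same big1_seq // => m' /andP[_ m'_in].
case: ifP => _; first by rewrite mcoeff0.
case: ifP => _; rewrite ?mcoeff0 // mcoeffZ mcoeffX.
by case: eqP m_out => [<-|]; rewrite ?m'_in ?mulr0.
Qed.

Lemma msupp_split_var (n : nat) (R : idomainType) (i : 'I_n)
    (p : {mpoly R[n]}) m :
  m \in msupp p -> (m i < size (split_var i p))%N.
Proof.
rewrite mcoeff_msupp ltnNge; apply: contra => /leq_sizeP/(_ _ (leqnn _)) sz.
by have := coef_split_var i p (m i) m; rewrite sz mcoeff0 eqxx => <-.
Qed.

(** The monomial [a + b] itself may cancel in the product, but the top degree in ['X_i] cannot, so
    some other monomial serves as witness. *)
Lemma msuppM_deg (n : nat) (R : idomainType) (i : 'I_n)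
    (p q : {mpoly R[n]}) a b :
  a \in msupp p -> b \in msupp q ->
  exists2 m, m \in msupp (p * q) & (a i + b i <= m i)%N.
Proof.
move=> /(msupp_split_var i) ap /(msupp_split_var i) bq.
have [k le_k] := coefM_neq0 ap bq; rewrite -split_varM => k_neq0.
have [m m_neq0] : exists m, (split_var i (p * q))`_k @_m != 0.
  apply: contrapT => /forallNP all0; case/eqP: k_neq0.
  by apply/mpolyP => m; rewrite mcoeff0; apply/eqP/contraT => /all0.
move: m_neq0; rewrite coef_split_var.
case: ifP => [/eqP k_eq|_]; last by rewrite eqxx.
by rewrite -mcoeff_msupp => m_in; exists m; rewrite -?k_eq.
Qed.

(** The coefficient sums over all pairs of monomials with product [a + b]; with a single such pair
    nothing can cancel. *)
Lemma mcoeffM_unique (n : nat) (R : nzRingType) (p q : {mpoly R[n]}) a b :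
  a \in msupp p -> b \in msupp q ->
  {in msupp p & msupp q, forall a' b',
    (a' + b')%MM = (a + b)%MM -> a' = a /\ b' = b} ->
  (p * q)@_(a + b) = p@_a * q@_b.
Proof.
move=> ap bq ab_uniq; rewrite mpolyME raddf_sum /=.
rewrite (bigD1_seq (a, b)) /=; first last.
- by apply: allpairs_uniq => // -[? ?] [? ?].
- by apply/allpairsP; exists (a, b).
rewrite mcoeffZ mcoeffX eqxx mulr1 big1_seq ?addr0 // => -[a' b'] /=.
move=> /andP[ne /allpairsP[[a1 b1] /= [a1p b1q [? ?]]]]; subst a1 b1.
rewrite mcoeffZ mcoeffX; case: eqP => [e|]; last by rewrite mulr0.
by have [ea eb] := ab_uniq _ _ a1p b1q e; rewrite ea eb eqxx in ne.
Qed.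

Lemma constant_or_var (n : nat) (p : {mpoly rat[n]}) :
  constant_mpoly p \/ exists2 m, m \in msupp p & exists i, (0 < m i)%N.
Proof.
have [|no_var] := EM (exists2 m, m \in msupp p & exists i, (0 < m i)%N).
  by right.
left; exists p@_0; apply/mpolyP => m; rewrite mcoeffC.
have [->|m0] := eqVneq m 0%MM; first by rewrite mulr1.
rewrite mulr0; apply/eqP/contraT; rewrite -mcoeff_msupp => m_in; case: no_var.
exists m => //; have [//|/forallNP m_zero] := EM (exists i, (0 < m i)%N).
move/negP: m0; case; apply/eqP/mnmP => i; rewrite mnm0E; apply/eqP.
by rewrite -leqn0 leqNgt; apply/negP.
Qed.

(** * Squarefree monomials of edge sets and the support of the Kirchhoff polynomial *)

Definition set_mnm (G : digraph) (A : {set edge G}) : 'X_{1.. #|edge G|} :=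
  [multinom (enum_val i \in A : nat) | i < #|edge G|].

Lemma set_mnmE (G : digraph) (A : {set edge G}) e :
  set_mnm A (enum_rank e) = (e \in A).
Proof. by rewrite mnmE enum_rankK. Qed.

Lemma set_mnm_inj (G : digraph) : injective (@set_mnm G).
Proof.
move=> A B AB; apply/setP => e; have := set_mnmE A e.
by rewrite AB set_mnmE; do 2!case: (e \in _).
Qed.

Lemma prod_set_mnm (G : digraph) (A : {set edge G}) :
  \prod_(e in A) 'X_(enum_rank e) = 'X_[set_mnm A] :> {mpoly rat[#|edge G|]}.
Proof.
rewrite mprodXE; congr 'X_[_]; apply/mnmP => i.
rewrite mnm_sumE -[i]enum_valK set_mnmE.
under eq_bigr => e _ do rewrite mnm1E.
have [iA|iA] := boolP (enum_val i \in A).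
  rewrite (bigD1 (enum_val i)) //= eqxx big1 // => e /andP[_].
  by rewrite (inj_eq enum_rank_inj) => /negPf->.
rewrite big1 // => e eA; rewrite (inj_eq enum_rank_inj).
by case: eqP iA => // <-; rewrite eA.
Qed.

Lemma mcoeff_kirchhoff (G : digraph) m :
  (kirchhoff G)@_m = \sum_(A in arb G) (set_mnm A == m)%:R.
Proof.
by rewrite raddf_sum; apply: eq_bigr => A _ /=; rewrite prod_set_mnm mcoeffX.
Qed.

Lemma msupp_kirchhoff (G : digraph) m :
  m \in msupp (kirchhoff G) -> exists2 A, A \in arb G & m = set_mnm A.
Proof.
rewrite mcoeff_msupp mcoeff_kirchhoff => sum_neq0.
have [/exists_inP[A hA /eqP<-]|/exists_inPn noA] :=
    boolP [exists A in arb G, set_mnm A == m]; first by exists A.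
by rewrite big1 ?eqxx // in sum_neq0 => A /noA/negPf->.
Qed.

(** Different arborescences have different monomials, so each of these has coefficient 1. *)
Lemma set_mnm_msupp (G : digraph) (A : {set edge G}) :
  (set_mnm A \in msupp (kirchhoff G)) = (A \in arb G).
Proof.
apply/idP/idP => [/msupp_kirchhoff[B hB /set_mnm_inj->] //|hA].
rewrite mcoeff_msupp mcoeff_kirchhoff (bigD1 A) //= eqxx big1 => [//|B].
by move=> /andP[_ BA]; rewrite (inj_eq (@set_mnm_inj G)) (negPf BA).
Qed.

(** * Distribution of the edges between two factors *)

Theorem theorem3p4 (G : digraph) (hG : strongly_connected G) :
  prime_mpoly (kirchhoff G).
Proof.
move=> P Q kPQ.
have [|[m0 m0P [i i_m0]]] := constant_or_var P; first by left.
have [|[n0 n0Q [j j_n0]]] := constant_or_var Q; first by right.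
exfalso.
pose S := [set e |
  has (fun m : 'X_{1.. _} => 0 < m (enum_rank e))%N (msupp P)].
have P_S a e : a \in msupp P -> e \notin S -> a (enum_rank e) = 0%N.
  rewrite inE => aP /hasPn/(_ a aP).
  by rewrite -eqn0Ngt => /eqP.
have Q_S b e : b \in msupp Q -> e \in S -> b (enum_rank e) = 0%N.
  rewrite inE => bQ /hasP[a aP ae].
  (* As [a] has positive degree in [e], a positive degree of [b] would give an arborescence monomial
     of degree at least 2 in [e]. *)
  have [m] := msuppM_deg (enum_rank e) aP bQ.
  rewrite -kPQ => /msupp_kirchhoff[A _ ->]; rewrite set_mnmE => ab.
  apply/eqP; rewrite -leqn0 -(leq_add2l 1).
  by apply: leq_trans (leq_trans ab (leq_b1 _)); rewrite leq_add2r.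
have supp_split A : A \in arb G ->
    exists a b, [/\ a \in msupp P, b \in msupp Q & set_mnm A = (a + b)%MM].
  rewrite -set_mnm_msupp kPQ => /msuppM_le/allpairsP[[a b] /= [aP bQ ->]].
  by exists a, b.
have [|S0|ST] := arb_exchange_trivial (S := S) hG.
- move=> A B /supp_split[a [b [aP bQ Aab]]] /supp_split[a' [b' [aP' bQ' Bab]]].
  rewrite -set_mnm_msupp.
  (* Exponents from [P] vanish off [S] and those from [Q] vanish on [S], so [a] encodes [A :&: S]
     and [b'] encodes [B :\: S]. *)
  have -> : set_mnm ((A :&: S) :|: (B :\: S)) = (a + b')%MM.
    apply/mnmP => k; rewrite -[k]enum_valK set_mnmE mnmDE.
    rewrite in_setU in_setI in_setD.
    set e := enum_val k.
    have := set_mnmE A e; have := set_mnmE B e; rewrite Aab Bab !mnmDE.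
    have [eS|eS] := boolP (e \in S).
      by rewrite (Q_S b e) ?(Q_S b' e) // => _ ->; rewrite andbT orbF.
    by rewrite (P_S a e) ?(P_S a' e) // => -> _; rewrite andbF.
  (* The same separation lets [a] and [b'] be recovered from their sum, so this monomial survives in
     [P * Q]. *)
  rewrite mcoeff_msupp kPQ mcoeffM_unique //.
    by rewrite mulf_neq0 // -mcoeff_msupp.
  move=> c d cP dQ /mnmP cd.
  have cdE e : (c (enum_rank e) + d (enum_rank e) =
      a (enum_rank e) + b' (enum_rank e))%N by rewrite -!mnmDE.
  split; apply/mnmP => k; rewrite -[k]enum_valK; move: (cdE (enum_val k));
    have [eS|eS] := boolP (enum_val k \in S).
  + by rewrite (Q_S d) // (Q_S b') // !addn0.
  + by rewrite (P_S c) // (P_S a).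
  + by rewrite (Q_S d) // (Q_S b').
  + by rewrite (P_S c) // (P_S a).
(* An empty [S] leaves no variable for [P], a full one none for [Q]. *)
- have := P_S m0 (enum_val i) m0P; rewrite S0 inE enum_valK => /(_ isT) m0i.
  by rewrite m0i in i_m0.
- have := Q_S n0 (enum_val j) n0Q; rewrite ST inE enum_valK => /(_ isT) n0j.
  by rewrite n0j in j_n0.
Qed.
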